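(* Let $0<q_{\min}\le q_{\max}<1$ be constants and $\delta\in(0,1)$. For any parameter $\gamma$, there are auxiliary distributions $\mathtt{Aux}[M,U\setminus M]$ (specifying real values of the entries of the query vector $\boldsymbol{v}\in\mathbb{R}^n$, with $v_i=0$ for $i\notin U\cup M$) such that for every sketching matrix $A\in\mathbb{R}^{k\times n}$ with $\gamma_0(A)\le\gamma$ there is a $\delta$-determining pool $L\subseteq[n]$ of size $O(k\log(k/\delta))$.
   Context: Real RAM model: the sketch $S=A\boldsymbol{v}\in\mathbb{R}^k$ is represented exactly. Denote the columns of $A$ by $a^{(i)}$. For a linearly independent set of column indices $B=(b_1,\dots,b_\ell)$, $F_B\in\mathbb{R}^{k\times k}$ is an invertible matrix with $F_Ba^{(b_j)}=e_j$ for all $j\le\ell$ ($e_j$ the standard basis vectors). $\gamma_0(A)$ is the largest possible magnitude of an entry of $F_BA$, over all bases $B$ (consisting of columns of $A$) of the column span and all such $F_B$. For $M\subseteq[n]$ and $U\subseteq[n]$, let $\mathcal{D}(M,U\setminus M)$ be the distribution of $A\boldsymbol{v}$ for $\boldsymbol{v}\sim\mathtt{Aux}[M,U\setminus M]$. A set $L\subseteq[n]$ is a $\delta$-determining pool if there are distributions $\mathcal{D}'(M,W)$ for all $M\subseteq L$, $W\subseteq L\setminus M$ such that for every $M\subseteq L$ and $q\in[q_{\min},q_{\max}]$, $\mathbb{E}_{U\sim\mathrm{Bern}[q]^{[n]}}\|\mathcal{D}(M,U\setminus M)-\mathcal{D}'(M,U\cap(L\setminus M))\|_{TV}\le\delta$,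 where $\mathrm{Bern}[q]^{[n]}$ includes each index independently with probability $q$. The implied constant in $O(\cdot)$ may depend on $q_{\min}$. *)

(* Defs.v *)
From HB Require Import structures.
From mathcomp Require Import all_boot all_order all_algebra.
From mathcomp Require Import all_classical all_reals all_analysis.
From mathcomp Require Import measurable_realfun.

Set Implicit Arguments.
Unset Strict Implicit.
Unset Printing Implicit Defensive.

Import Order.TTheory GRing.Theory Num.Theory.
Local Open Scope classical_set_scope.
Local Open Scope ring_scope.

(* [R^m] is [m.-tuple R] with its product (Borel) sigma-algebra, since this is
   the library's measurable structure; matrices carry none. *)
Definition sketch (R : realType) (k n : nat) (A : 'M[R]_(k, n))
    (v : n.-tuple R) : k.-tuple R :=
  [tuple (A *m \col_(j < n) tnth v j) i 0 | i < k].

Lemma measurable_sketch (R : realType) (k n : nat) (A : 'M[R]_(k, n)) :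
  measurable_fun [set: n.-tuple R] (sketch A).
Proof.
apply/measurable_fun_tnthP => i.
rewrite (_ : _ \o _ = fun v : n.-tuple R => \sum_(j < n) A i j * tnth v j).
  apply: measurable_sum => j; apply: measurable_funM; first exact: measurable_cst.
  exact: measurable_tnth.
apply/funext => v /=; rewrite tnth_mktuple mxE.
by apply: eq_bigr => j _; rewrite mxE.
Qed.

HB.instance Definition _ (R : realType) (k n : nat) (A : 'M[R]_(k, n)) :=
  isMeasurableFun.Build _ _ _ _ (sketch A) (measurable_sketch A).

(* The columns of [A] indexed by [b] are linearly independent and span the
   column space of [A]; MathComp's [row_free] and [<=] are about rows, hence
   the transpositions. *)
Definition is_column_basis (R : realType) (k n : nat) (A : 'M[R]_(k, n))
    (l : nat) (b : l.-tuple 'I_n) : Prop :=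
  row_free (colsub (tnth b) A)^T /\ (A^T <= (colsub (tnth b) A)^T)%MS.

(* [F] is an admissible [F_B]: invertible, and [F a^(b_j) = e_j] for all [j]. *)
Definition is_basis_change (R : realType) (k n : nat) (A : 'M[R]_(k, n))
    (l : nat) (b : l.-tuple 'I_n) (F : 'M[R]_k) : Prop :=
  F \in unitmx /\
  forall j : 'I_l,
    F *m col (tnth b j) A = \col_(i < k) (i == j :> nat)%:R.

(* The supremum is taken in [\bar R], so that [gamma0 A <= c%:E] says exactly
   that all entries are bounded by [c]. *)
Definition gamma0 (R : realType) (k n : nat) (A : 'M[R]_(k, n)) : \bar R :=
  ereal_sup [set x : \bar R |
    exists (l : nat) (b : l.-tuple 'I_n) (F : 'M[R]_k) (i : 'I_k) (j : 'I_n),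
      [/\ is_column_basis A b, is_basis_change A b F
        & x = (`|(F *m A) i j|)%:E]].

Definition tv_dist (R : realType) (d : measure_display) (T : measurableType d)
    (P Q : probability T R) : R :=
  sup [set `|fine (P E) - fine (Q E)| | E in [set E : set T | measurable E]].

(* Probability of [U] under [Bern[q]^[n]]. *)
Definition bern_weight (R : realType) (n : nat) (q : R) (U : {set 'I_n}) : R :=
  \prod_(i < n) (if i \in U then q else 1 - q).

(* A query represents the set [U :|: M]: its entries are zero outside [U :|: M]
   and are actual (nonzero) values on [U :|: M].  Without the second half the
   zero vector would be an admissible query for every set. *)
Definition valid_aux (R : realType) (n : nat)
    (Aux : {set 'I_n} -> {set 'I_n} -> probability (n.-tuple R) R) : Prop :=
  forall M U : {set 'I_n},
    {ae Aux M (U :\: M), forall v : n.-tuple R,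
      (forall i, i \notin U :|: M -> tnth v i = 0) /\
      (forall i, i \in U :|: M -> tnth v i <> 0)}.

(* [D(M, W)]: the law of [A v] for [v ~ Aux[M, W]]. *)
Definition sketch_law (R : realType) (k n : nat) (A : 'M[R]_(k, n))
    (Aux : {set 'I_n} -> {set 'I_n} -> probability (n.-tuple R) R)
    (M W : {set 'I_n}) : probability (k.-tuple R) R :=
  distribution (Aux M W) (sketch A).

(* [D'] is only ever used at [M \subset L] and [W \subset L :\: M]; its other
   values are irrelevant. *)
Definition determining_pool (R : realType) (k n : nat) (A : 'M[R]_(k, n))
    (Aux : {set 'I_n} -> {set 'I_n} -> probability (n.-tuple R) R)
    (qmin qmax delta : R) (L : {set 'I_n}) : Prop :=
  exists D' : {set 'I_n} -> {set 'I_n} -> probability (k.-tuple R) R,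
    forall (M : {set 'I_n}) (q : R), M \subset L -> qmin <= q <= qmax ->
      \sum_(U : {set 'I_n}) bern_weight q U *
        tv_dist (sketch_law A Aux M (U :\: M)) (D' M (U :&: (L :\: M)))
      <= delta.

(* Main.v *)
(** The entries of a query are independent and uniform, the [j]-th one on
    [[0, eta ^+ j]] with [eta] tiny.  Adding [c] times column [j] of a matrix [B]
    to column [i <> j] changes the law of [B x], [x] uniform on the unit cube, by
    at most [|c|] in total variation, because conditionally on the other
    coordinates it translates [x_j] by [c x_i].  Hence a column that is a
    combination, with coefficients bounded by [gamma], of present columns of
    smaller index can be deleted at cost [O(n gamma eta)]: it is masked.

    The pool is the union of [t = O(log (k / delta))] disjoint bases, each one the
    lexicographically first basis of the columns left by the previous ones.
    Let the deficiency be the rank that the next basis, cut at a column [b], still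
    adds to the sampled part of the previous ones.  By submodularity of the rank
    its mean is multiplied by at most [1 - q] with each basis, so that a union
    bound over the [k] columns of basis [t + 1] shows that, up to probability
    [k ^ 2 (1 - q) ^ t], all columns outside the pool are masked.

    When [k = 1] and [delta] is close to [1] the required bound on the size of the
    pool is below [1], and the empty pool works: the first nonzero column masks
    all others, and is sampled with probability at least [qmin]. *)
Require Import Defs.
From HB Require Import structures.
From mathcomp Require Import all_boot all_order all_algebra.
From mathcomp Require Import all_classical all_reals all_analysis.
From mathcomp Require Import measurable_realfun ring lra.

Set Implicit Arguments.
Unset Strict Implicit.
Unset Printing Implicit Defensive.

Import Order.TTheory GRing.Theory Num.Theory.
Local Open Scope classical_set_scope.
Local Open Scope ring_scope.

(** * Uniform laws and column operations *)

Lemma measurable_preimageT d d' (T : measurableType d) (T' : measurableType d')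
    (f : T -> T') (F : set T') :
  measurable_fun [set: T] f -> measurable F -> measurable (f @^-1` F).
Proof. by move=> mf mF; rewrite -[X in measurable X]setTI; exact: mf. Qed.

Definition translate (R : realType) (h : R) (x : measurableTypeR R) :
  measurableTypeR R := x + h.

Lemma measurable_translate (R : realType) (h : R) :
  measurable_fun [set: measurableTypeR R] (translate h).
Proof. by apply: measurable_funD => //; exact: measurable_cst. Qed.

(** The pushforward under the translation agrees with Lebesgue measure on half-open intervals, which
    determine it. *)
Lemma lebesgue_measure_translate (R : realType) (h : R)
    (F : set (measurableTypeR R)) : measurable F ->
  lebesgue_measure (translate h @^-1` F) = lebesgue_measure F.
Proof.
move=> mF; symmetry.
pose nu : {measure set (measurableTypeR R) -> \bar R} :=
  pushforward (@lebesgue_measure R)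
    (translate h).
suff : lebesgue_measure F = nu (measurable_translate h) F by [].
apply: lebesgue_measure_unique => // _ [[a b] ab <-].
rewrite /nu /= /pushforward.
rewrite (_ : _ @^-1` _ = `](a - h), (b - h)]%classic); last first.
  by apply/seteqP; split => x /=; rewrite !in_itv /= ltrBlDr lerBrDr.
rewrite !lebesgue_measure_itv /= !lte_fin ltrD2r.
by case: ifP => // _; rewrite -!EFinB; congr EFin; ring.
Qed.

(* The library's uniform law lives on [measurableTypeR R], whose measurable
   structure has another display than the canonical one of [R]. *)
Definition of_measurableTypeR (R : realType) (x : measurableTypeR R) : R := x.

Lemma measurable_of_measurableTypeR (R : realType) :
  measurable_fun setT (@of_measurableTypeR R).
Proof. by move=> _ F mF; rewrite setTI. Qed.

HB.instance Definition _ (R : realType) :=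
  isMeasurableFun.Build _ _ _ _ (@of_measurableTypeR R)
    (@measurable_of_measurableTypeR R).

Definition unit_law (R : realType) : probability R R :=
  distribution (uniform_prob (@ltr01 R)) (@of_measurableTypeR R).

Lemma unit_lawE (R : realType) (F : set R) : measurable F ->
  unit_law R F = lebesgue_measure (F `&` `[0, 1]%classic).
Proof.
move=> mF; rewrite /unit_law /= /distribution /pushforward /uniform_prob integral_uniform_pdf.
rewrite (eq_integral (fun=> 1%:E)); last first.
  move=> x; rewrite inE => -[_ /=]; rewrite in_itv /= => x01.
  by rewrite /uniform_pdf x01 subr0 invr1.
by rewrite integral_cst ?mul1e//; exact: measurableI.
Qed.

Lemma unit_law_translate (R : realType) (h c : R) (F : set R) :
  measurable F -> `|h| <= c ->
  (unit_law R (translate h @^-1` F) <= unit_law R F + c%:E)%E.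
Proof.
move=> mF hc.
rewrite !unit_lawE//; last first.
  by apply: measurable_preimageT mF; exact: measurable_translate.
rewrite (_ : _ `&` _ = translate h @^-1` (F `&` `[h, 1 + h]%classic)); last first.
  by apply/seteqP; split => x /=; rewrite !in_itv /= /translate lerDr lerD2r.
rewrite lebesgue_measure_translate//; last exact: measurableI.
(* [G] covers what [[h, 1 + h]] has outside [[0, 1]]: an interval of length at most [|h|], on the
   right or on the left according to the sign of [h]. *)
have key (G : set (measurableTypeR R)) : measurable G ->
    `[h, 1 + h]%classic `<=` `[0, 1]%classic `|` G -> (lebesgue_measure G <= c%:E)%E ->
    (lebesgue_measure (F `&` `[h, (1 + h)%R]%classic) <=
     lebesgue_measure (F `&` `[0%R, 1%R]%classic) + c%:E)%E.
  move=> mG sub Gc.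
  have mF01 : measurable (F `&` `[0%R, 1%R]%classic : set (measurableTypeR R)).
    exact: measurableI.
  apply: (@le_trans _ _ (lebesgue_measure ((F `&` `[0%R, 1%R]%classic) `|` G))).
    apply: le_measure; rewrite ?inE; [exact: measurableI|exact: measurableU|].
    by move=> x [Fx /sub[]]; [left|right].
  by apply: (le_trans (measureU2 _ _ _)) => //; rewrite leeD2l.
have [h0|h0] := leP 0 h.
  apply: (key `]1, 1 + h]%classic) => //.
    move=> x /=; rewrite !in_itv /= => /andP[hx xh].
    have [x1|x1] := leP x 1; first by left; rewrite (le_trans h0 hx).
    by right; rewrite xh.
  rewrite lebesgue_measure_itv /= lte_fin; case: ifP => _.
    by rewrite -EFinB lee_fin; apply: le_trans hc; rewrite ger0_norm//; lra.
  by rewrite lee_fin (le_trans _ hc).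
apply: (key `[h, 0[%classic) => //.
  move=> x /=; rewrite !in_itv /= => /andP[hx xh].
  have [x1|x1] := leP 0 x; first by left; lra.
  by right; rewrite hx.
rewrite lebesgue_measure_itv /= lte_fin; case: ifP => _.
  by rewrite -EFinB lee_fin; apply: le_trans hc; rewrite ltr0_norm//; lra.
by rewrite lee_fin (le_trans _ hc).
Qed.

Definition tuple_cons (R : realType) (n : nat)
    (p : R * n.-tuple R) : n.+1.-tuple R := [the n.+1.-tuple R of p.1 :: p.2].

Lemma measurable_tuple_cons (R : realType) (n : nat) :
  measurable_fun setT (@tuple_cons R n).
Proof. by apply: (@measurable_cons _ _ _ _ fst _ snd). Qed.

HB.instance Definition _ (R : realType) (n : nat) :=
  isMeasurableFun.Build _ _ _ _ (@tuple_cons R n) (@measurable_tuple_cons R n).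

(** Built one coordinate at a time, so that Fubini's theorem supports induction on the dimension. *)
Fixpoint cube_law (R : realType) (n : nat) : probability (n.-tuple R) R :=
  match n with
  | 0 => dirac [tuple]
  | m.+1 => distribution (unit_law R \x cube_law R m)%E (@tuple_cons R m)
  end.

Lemma cube_lawS (R : realType) (n : nat) (F : set (n.+1.-tuple R)) :
  cube_law R n.+1 F =
  (unit_law R \x cube_law R n)%E (@tuple_cons R n @^-1` F).
Proof. by []. Qed.

Opaque unit_law cube_law.

Lemma integral_cst_probability d (T : measurableType d) (R : realType)
    (P : probability T R) (c : \bar R) : (\int[P]_x c = c)%E.
Proof. by rewrite integral_cst//= [X in (_ * X)%E]probability_setT mule1. Qed.

Lemma cube_lawE1 (R : realType) (n : nat) (F : set (n.+1.-tuple R)) :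
  cube_law R n.+1 F =
  (\int[unit_law R]_x cube_law R n [set t | F (tuple_cons (x, t))])%E.
Proof.
rewrite cube_lawS /product_measure1; apply: eq_integral => x _.
by congr (cube_law R n _); apply/seteqP; split => t; rewrite /xsection /= inE.
Qed.

Lemma cube_lawE2 (R : realType) (n : nat) (F : set (n.+1.-tuple R)) :
  measurable F ->
  cube_law R n.+1 F =
  (\int[cube_law R n]_t unit_law R [set x | F (tuple_cons (x, t))])%E.
Proof.
move=> mF; rewrite cube_lawS.
rewrite (@product_measure_unique _ _ _ _ _ _ _ (unit_law R \x^ cube_law R n)%E).
- rewrite /product_measure2; apply: eq_integral => t _.
  by congr (unit_law R _); apply/seteqP; split => x; rewrite /ysection /= inE.
- by move=> A B mA mB; exact: product_measure2E.
- by apply: measurable_preimageT mF; exact: measurable_tuple_cons.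
Qed.

Lemma measurable_tuple_cons_section1 (R : realType) (n : nat) (x : R)
    (F : set (n.+1.-tuple R)) :
  measurable F -> measurable [set t : n.-tuple R | F (tuple_cons (x, t))].
Proof.
move=> mF; apply: (@measurable_preimageT _ _ _ _
  (fun t : n.-tuple R => tuple_cons (x, t)) F) => //.
by apply: (@measurable_cons _ _ _ _ (cst x) _ id).
Qed.

Lemma measurable_tuple_cons_section2 (R : realType) (n : nat) (t : n.-tuple R)
    (F : set (n.+1.-tuple R)) :
  measurable F -> measurable [set x : R | F (tuple_cons (x, t))].
Proof.
move=> mF; apply: (@measurable_preimageT _ _ _ _
  (fun x : R => tuple_cons (x, t)) F) => //.
by apply: (@measurable_cons _ _ _ _ id _ (cst t)).
Qed.

Lemma measurable_cube_law_section (R : realType) (n : nat)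
    (F : set (n.+1.-tuple R)) : measurable F ->
  measurable_fun [set: R]
    (fun x => cube_law R n [set t | F (tuple_cons (x, t))]).
Proof.
move=> mF; have mF' : measurable (@tuple_cons R n @^-1` F).
  by apply: measurable_preimageT mF; exact: measurable_tuple_cons.
rewrite (_ : (fun x => _) = cube_law R n \o xsection (@tuple_cons R n @^-1` F)).
  exact: measurable_fun_xsection.
apply/funext => x; congr (cube_law R n _).
by apply/seteqP; split => t; rewrite /xsection /= inE.
Qed.

Lemma measurable_unit_law_section (R : realType) (n : nat)
    (F : set (n.+1.-tuple R)) : measurable F ->
  measurable_fun [set: n.-tuple R]
    (fun t => unit_law R [set x | F (tuple_cons (x, t))]).
Proof.
move=> mF; have mF' : measurable (@tuple_cons R n @^-1` F).
  by apply: measurable_preimageT mF; exact: measurable_tuple_cons.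
rewrite (_ : (fun t => _) = unit_law R \o ysection (@tuple_cons R n @^-1` F)).
  exact: measurable_fun_ysection.
apply/funext => t; congr (unit_law R _).
by apply/seteqP; split => x; rewrite /ysection /= inE.
Qed.

Lemma cube_law_coord (R : realType) (n : nat) (i : 'I_n) (F : set R) :
  measurable F -> cube_law R n [set x | F (tnth x i)] = unit_law R F.
Proof.
move=> mF; elim: n i => [[]//|n IHn] i.
have mFi : measurable [set x : n.+1.-tuple R | F (tnth x i)].
  by apply: (@measurable_preimageT _ _ _ _ (@tnth n.+1 R ^~ i) F) => //;
    exact: measurable_tnth.
case: (unliftP ord0 i) => [j|] ij; last first.
  rewrite cube_lawE2// (eq_integral (fun=> unit_law R F)); last first.
    by move=> t _; rewrite ij.
  exact: integral_cst_probability.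
rewrite cube_lawE1 (eq_integral (fun=> unit_law R F)); last first.
  move=> x _; rewrite -(IHn j); congr (cube_law R n _).
  by apply/seteqP; split => t /=; rewrite ij tnthS.
exact: integral_cst_probability.
Qed.

(** For [h x = c * tnth x i] this is an elementary column operation seen on points
    ([sketch_bump_coord]); a general [h] lets coordinates be frozen in an induction. *)
Definition bump_coord (R : realType) (n : nat) (j : 'I_n)
    (h : n.-tuple R -> R) (x : n.-tuple R) : n.-tuple R :=
  [tuple tnth x i + (i == j)%:R * h x | i < n].

Lemma measurable_bump_coord (R : realType) (n : nat) (j : 'I_n)
    (h : n.-tuple R -> R) : measurable_fun [set: n.-tuple R] h ->
  measurable_fun [set: n.-tuple R] (bump_coord j h).
Proof.
move=> mh; apply/measurable_fun_tnthP => i.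
rewrite (_ : _ \o _ = fun x => tnth x i + (i == j)%:R * h x); last first.
  by apply/funext => x /=; rewrite tnth_mktuple.
by apply: measurable_funD; [exact: measurable_tnth|exact: measurable_funM].
Qed.

Lemma tnth_tuple_cons0 (R : realType) (n : nat) (x : R) (t : n.-tuple R) :
  tnth (tuple_cons (x, t)) ord0 = x.
Proof. by []. Qed.

Lemma tnth_tuple_cons_lift (R : realType) (n : nat) (x : R) (t : n.-tuple R)
    (i : 'I_n) : tnth (tuple_cons (x, t)) (lift ord0 i) = tnth t i.
Proof. by rewrite tnthS. Qed.

Lemma bump_coord_lift (R : realType) (n : nat) (j : 'I_n)
    (h : n.+1.-tuple R -> R) (x : R) (t : n.-tuple R) :
  bump_coord (lift ord0 j) h (tuple_cons (x, t)) =
  tuple_cons (x, bump_coord j (fun t => h (tuple_cons (x, t))) t).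
Proof.
apply: eq_from_tnth => i; rewrite tnth_mktuple.
case: (unliftP ord0 i) => [i'|] ->.
  by rewrite !tnth_tuple_cons_lift tnth_mktuple (inj_eq lift_inj).
by rewrite !tnth_tuple_cons0 (negbTE (neq_lift _ _)) mul0r addr0.
Qed.

Lemma bump_coord0 (R : realType) (n : nat)
    (h : n.+1.-tuple R -> R) (x : R) (t : n.-tuple R) :
  bump_coord ord0 h (tuple_cons (x, t)) =
  tuple_cons (translate (h (tuple_cons (x, t))) x, t).
Proof.
apply: eq_from_tnth => i; rewrite tnth_mktuple.
case: (unliftP ord0 i) => [i'|] ->; last by rewrite !tnth_tuple_cons0 eqxx mul1r.
by rewrite !tnth_tuple_cons_lift eq_sym (negbTE (neq_lift _ _)) mul0r addr0.
Qed.

(** Given the other coordinates, [h] is constant, and the map translates one uniform variable by at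
    most [c]. *)
Lemma cube_law_bump_coord (R : realType) (n : nat) (j : 'I_n)
    (h : n.-tuple R -> R) (c : R) (F : set (n.-tuple R)) :
  measurable_fun [set: n.-tuple R] h ->
  (forall x y, (forall i, i != j -> tnth x i = tnth y i) -> h x = h y) ->
  (forall x, `|h x| <= c) -> measurable F ->
  (cube_law R n (bump_coord j h @^-1` F) <= cube_law R n F + c%:E)%E.
Proof.
elim: n j h F => [[]//|n IHn] j h F mh hj hc mF.
have mbF : measurable (bump_coord j h @^-1` F).
  by apply: measurable_preimageT mF; exact: measurable_bump_coord.
have c0 : 0 <= c by apply: le_trans (hc [tuple 0 | i < n.+1]).
case: (unliftP ord0 j) => [j'|] jE.
  (* A later coordinate: freeze the first one and apply the induction hypothesis to the sections. *)
  rewrite !cube_lawE1 -(integral_cst_probability (unit_law R) c%:E).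
  rewrite -ge0_integralD//; last exact: measurable_cube_law_section.
  apply: ge0_le_integral => //.
  - exact: measurable_cube_law_section.
  - by apply: emeasurable_funD => //; exact: measurable_cube_law_section.
  move=> x _; pose h' t := h (tuple_cons (x, t)).
  rewrite (_ : [set t | _] = bump_coord j' h' @^-1`
      [set t | F (tuple_cons (x, t))]); last first.
    by apply/seteqP; split => t; rewrite /= jE bump_coord_lift.
  apply: IHn.
  + apply: measurableT_comp => //.
    by apply: (@measurable_cons _ _ _ _ (cst x) _ id).
  + move=> t t' tt'; apply: hj => i; case: (unliftP ord0 i) => [i'|] ->//.
    by rewrite jE (inj_eq lift_inj) !tnth_tuple_cons_lift; exact: tt'.
  + by move=> t; exact: hc.
  + exact: measurable_tuple_cons_section1.
(* The first coordinate: integrate over it innermost. The shift can be read off at [0], since [h]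
   ignores this coordinate. *)
rewrite !cube_lawE2// -(integral_cst_probability (cube_law R n) c%:E).
rewrite -ge0_integralD//; last exact: measurable_unit_law_section.
apply: ge0_le_integral => //.
- exact: measurable_unit_law_section.
- by apply: emeasurable_funD => //; exact: measurable_unit_law_section.
move=> t _.
rewrite (_ : [set x | _] = translate (h (tuple_cons (0, t))) @^-1`
    [set x | F (tuple_cons (x, t))]); last first.
  have hE x : h (tuple_cons (x, t)) = h (tuple_cons (0, t)).
    apply: hj => i; rewrite jE; case: (unliftP ord0 i) => [i'|] ->; last by rewrite eqxx.
    by rewrite !tnth_tuple_cons_lift.
  by apply/seteqP; split => x; rewrite /= jE bump_coord0 (hE x).
by apply: unit_law_translate => //; exact: measurable_tuple_cons_section2.
Qed.

(** Zero coordinates are included: outside this null set a coordinate is at most [1], as shears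
    require, and nonzero, as valid queries require. *)
Definition off_unit (R : realType) (n : nat) (i : 'I_n) : set (n.-tuple R) :=
  [set x | ~ 0 < tnth x i <= 1].

Lemma measurable_not_itv01 (R : realType) : measurable [set x : R | ~ 0 < x <= 1].
Proof.
rewrite (_ : [set x | _] = ~` `]0, 1]%classic); first exact: measurableC.
by apply/seteqP; split => x /=; rewrite in_itv.
Qed.

Lemma measurable_off_unit (R : realType) (n : nat) (i : 'I_n) :
  measurable (@off_unit R n i).
Proof.
by apply: (@measurable_preimageT _ _ _ _ (@tnth n R ^~ i))
  (@measurable_not_itv01 R);
  exact: measurable_tnth.
Qed.

Lemma cube_law_off_unit (R : realType) (n : nat) (i : 'I_n) :
  cube_law R n (off_unit i) = 0.
Proof.
rewrite (cube_law_coord i (@measurable_not_itv01 R)) unit_lawE//;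
  last exact: measurable_not_itv01.
apply/eqP; rewrite eq_le measure_ge0 andbT.
rewrite -(lebesgue_measure_set1 (0 : R)); apply: le_measure; rewrite ?inE//.
  by apply: measurableI => //; exact: measurable_not_itv01.
move=> x [] /= nx; rewrite in_itv /= => /andP[x0 x1].
by apply/eqP; rewrite eq_le x0 andbT leNgt; apply/negP => xgt0; apply: nx; rewrite xgt0.
Qed.

Lemma cube_law_shear (R : realType) (n : nat) (i j : 'I_n) (c : R)
    (F : set (n.-tuple R)) : i != j -> measurable F ->
  (cube_law R n (bump_coord j (fun x => (c * tnth x i)%R) @^-1` F)
   <= cube_law R n F + `|c|%:E)%E.
Proof.
move=> ij mF.
(* The shift [c * tnth x i] is bounded by [|c|] only on the cube. Clipping bounds it everywhere and
   changes nothing outside the null set [off_unit i]. *)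
pose clip (y : R) := Num.max 0 (Num.min 1 y).
have mclip : measurable_fun [set: R] clip.
  by apply: measurable_maxr => //; apply: measurable_minr.
pose h x := c * clip (@tnth n R x i).
have mt : measurable_fun [set: n.-tuple R] (fun x => @tnth n R x i).
  exact: measurable_tnth.
have mh : measurable_fun [set: n.-tuple R] h.
  by apply: measurable_funM => //; exact: (measurableT_comp mclip mt).
have mh' : measurable_fun [set: n.-tuple R] (fun x => c * @tnth n R x i).
  exact: measurable_funM.
have mbh : measurable (bump_coord j h @^-1` F).
  by apply: measurable_preimageT mF; exact: measurable_bump_coord.
have mU := @measurable_off_unit R n i.
apply: (@le_trans _ _ (cube_law R n (bump_coord j h @^-1` F `|` off_unit i))).
  apply: le_measure; rewrite ?inE.
  - by apply: measurable_preimageT mF; exact: measurable_bump_coord.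
  - exact: measurableU.
  move=> x Fx; have [/andP[x0 x1]|] := boolP (0 < tnth x i <= 1); last by move/negP; right.
  left; rewrite /preimage /= (_ : bump_coord j h x = bump_coord j (fun x => c * tnth x i) x)//.
  apply: eq_from_tnth => l; rewrite !tnth_mktuple /h /clip.
  by rewrite (min_idPr x1) (max_idPr (ltW x0)).
apply: le_trans (measureU2 _ mbh mU) _.
rewrite [X in (_ + X <= _)%E](_ : _ = 0%E) ?adde0; last exact: cube_law_off_unit.
apply: cube_law_bump_coord => //.
- by move=> x y xy; rewrite /h xy.
- move=> x; rewrite normrM ler_piMr// ger0_norm ?le_max ?lexx//.
  by rewrite ge_max ler01 ge_min lexx.
Qed.

(** * Laws of linear images of a uniform point of the cube *)

Definition mx_law (R : realType) (k n : nat) (B : 'M[R]_(k, n)) :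
  probability (k.-tuple R) R := distribution (cube_law R n) (sketch B).

Lemma mx_lawE (R : realType) (k n : nat) (B : 'M[R]_(k, n))
    (E : set (k.-tuple R)) : mx_law B E = cube_law R n (sketch B @^-1` E).
Proof. by []. Qed.

Lemma sketch_bump_coord (R : realType) (k n : nat) (B : 'M[R]_(k, n))
    (i j : 'I_n) (c : R) (x : n.-tuple R) :
  sketch B (bump_coord j (fun x => c * tnth x i) x) =
  sketch (B *m (1%:M + c *: delta_mx j i)) x.
Proof.
rewrite /sketch (_ : \col_l tnth (bump_coord _ _ _) l =
  (1%:M + c *: delta_mx j i) *m \col_l tnth x l) ?mulmxA//.
rewrite mulmxDl mul1mx -scalemxAl; apply/colP => l; rewrite !mxE tnth_mktuple.
congr (_ + _); rewrite mulrCA; congr (_ * _).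
rewrite (bigD1 i)//= big1 => [|l' li]; rewrite !mxE ?eqxx ?andbT ?addr0//.
by rewrite (negbTE li) andbF mul0r.
Qed.

Lemma mx_law_shear (R : realType) (k n : nat) (B : 'M[R]_(k, n))
    (i j : 'I_n) (c : R) (E : set (k.-tuple R)) : i != j -> measurable E ->
  (mx_law (B *m (1%:M + c *: delta_mx j i)) E <= mx_law B E + `|c|%:E)%E.
Proof.
move=> ij mE; rewrite !mx_lawE.
have mF : measurable (sketch B @^-1` E).
  by apply: measurable_preimageT mE; exact: measurable_sketch.
rewrite (_ : _ @^-1` E = bump_coord j (fun x => c * tnth x i) @^-1` (sketch B @^-1` E)).
  exact: cube_law_shear.
by apply/seteqP; split => x; rewrite /preimage /= sketch_bump_coord.
Qed.

(** Rows of nonzero entries of [N] lie in [W] and columns outside it, so products of two elementary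
    terms vanish. Hence [1%:M + N] is a product of shears, whose costs add up. *)
Lemma mx_law_unipotent (R : realType) (k n : nat) (B : 'M[R]_(k, n))
    (N : 'M[R]_n) (W : {set 'I_n}) (E : set (k.-tuple R)) :
  (forall j i, N j i != 0 -> (j \in W) && (i \notin W)) -> measurable E ->
  (mx_law (B *m (1%:M + N)) E
   <= mx_law B E + (\sum_j \sum_i `|N j i|)%:E)%E.
Proof.
move=> NW mE.
suff H (s : seq ('I_n * 'I_n)) :
    (mx_law (B *m (1%:M + \sum_(p <- s) N p.1 p.2 *: delta_mx p.1 p.2)) E
     <= mx_law B E + (\sum_(p <- s) `|N p.1 p.2|)%:E)%E.
  have := H (index_enum _).
  rewrite -(pair_bigA _ (fun j i => N j i *: delta_mx j i)).
  by rewrite -(pair_bigA _ (fun j i => `|N j i|)) /= -matrix_sum_delta.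
elim: s => [|[j i] s IHs]; first by rewrite !big_nil addr0 mulmx1 adde0.
rewrite !big_cons /=; set Ns := \sum_(p <- s) _ in IHs *.
have [N0|N0] := eqVneq (N j i) 0; first by rewrite N0 scale0r normr0 !add0r.
have /andP[jW iW] := NW _ _ N0.
have -> : B *m (1%:M + (N j i *: delta_mx j i + Ns)) =
    B *m (1%:M + Ns) *m (1%:M + N j i *: delta_mx j i).
  rewrite -mulmxA; congr (_ *m _).
  rewrite mulmxDr mulmx1 mulmxDl mul1mx.
  suff -> : Ns *m (N j i *: delta_mx j i) = 0 by rewrite addr0 -addrA [Ns + _]addrC.
  rewrite /Ns mulmx_suml big1// => -[j' i'] _ /=.
  have [->|N'0] := eqVneq (N j' i') 0; first by rewrite scale0r mul0mx.
  have /andP[_ i'W] := NW _ _ N'0.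
  rewrite -scalemxAl -scalemxAr mul_delta_mx_0 ?scaler0//.
  by apply: contraNneq i'W => ->.
apply: le_trans (mx_law_shear _ _ _ mE) _; first by apply: contraNneq iW => ->.
rewrite [X in (_ <= _ + X%:E)%E]addrC EFinD addeA; exact: leeD2r.
Qed.

(** The one-sided bound at the complement of an event gives the other side. *)
Lemma tv_dist_le (R : realType) d (T : measurableType d)
    (P Q : probability T R) (c : R) :
  (forall E, measurable E -> (P E <= Q E + c%:E)%E) -> tv_dist P Q <= c.
Proof.
move=> PQ.
have PQ' E : measurable E -> fine (P E) <= fine (Q E) + c.
  by move=> mE; rewrite -lee_fin EFinD !fineK ?fin_num_measure//; exact: PQ.
apply: ge_sup; first by eexists; exists set0; [exact: measurable0|reflexivity].
move=> _ [E /= mE <-].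
have mEC : measurable (~` E) by exact: measurableC.
have := PQ' _ mEC; rewrite !probability_setC// !fineB ?fin_num_measure//= => h1.
have h2 := PQ' _ mE.
by rewrite ler_norml; lra.
Qed.

Lemma tv_dist_le1 (R : realType) d (T : measurableType d)
    (P Q : probability T R) : tv_dist P Q <= 1.
Proof.
apply: tv_dist_le => E mE; apply: (le_trans (probability_le1 P mE)).
by rewrite leeDr.
Qed.

(** * Masking *)

(* The scale [eta ^+ j] of the [j]-th entry decreases in [j]: a column of index
   [i] spanned by columns of smaller indices is then masked by them. *)
Definition scale_mx (R : realType) (n : nat) (eta : R) (U : {set 'I_n}) : 'M[R]_n :=
  diag_mx (\row_j (if j \in U then eta ^+ j else 0)).

Definition aux_law (R : realType) (n : nat) (eta : R) (M W : {set 'I_n}) :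
  probability (n.-tuple R) R := mx_law (scale_mx eta (W :|: M)).

Lemma tnth_sketch_scale_mx (R : realType) (n : nat) (eta : R) (U : {set 'I_n})
    (x : n.-tuple R) (i : 'I_n) :
  tnth (sketch (scale_mx eta U) x) i =
  if i \in U then eta ^+ i * tnth x i else 0.
Proof.
rewrite tnth_mktuple mxE (bigD1 i)//= big1 => [|j ji]; rewrite !mxE ?eqxx.
  by rewrite mulr1n addr0; case: ifP => // _; rewrite mul0r.
by rewrite eq_sym (negbTE ji) mulr0n mul0r.
Qed.

(** An entry on the support vanishes only if its uniform coordinate does, which is a null event. *)
Lemma valid_aux_law (R : realType) (n : nat) (eta : R) :
  0 < eta -> valid_aux (@aux_law R n eta).
Proof.
move=> eta0 M U; rewrite /aux_law (_ : U :\: M :|: M = U :|: M)%SET; last first.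
  by apply/setP => i; rewrite !inE; case: (i \in M); rewrite ?orbT ?orbF.
set V := (U :|: M)%SET; set mu := mx_law _.
pose P (i : 'I_n) (v : n.-tuple R) := (i \notin V -> tnth v i = 0) /\
  (i \in V -> tnth v i <> 0).
have H i : {ae mu, forall v, P i v}.
  have mz : measurable [set v : n.-tuple R | tnth v i = 0].
    apply: (@measurable_preimageT _ _ _ _ (@tnth n R ^~ i) [set 0]).
      exact: measurable_tnth.
    exact: measurable_set1.
  have [iV|iV] := boolP (i \in V).
    exists [set v | tnth v i = 0]; split => //; last first.
      by move=> v /= nP; apply: contrapT => v0; apply: nP; rewrite /P iV; split.
    rewrite mx_lawE; apply/eqP; rewrite eq_le measure_ge0 andbT.
    rewrite -(@cube_law_off_unit R n i); apply: le_measure; rewrite ?inE.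
    - by apply: measurable_preimageT mz; exact: measurable_sketch.
    - exact: measurable_off_unit.
    move=> x; rewrite /preimage /= tnth_sketch_scale_mx iV => /eqP.
    rewrite mulf_eq0 expf_eq0 (gt_eqF eta0) andbF /= => /eqP xi0.
    by rewrite /off_unit /= xi0 ltxx.
  exists [set v | tnth v i <> 0]; split => //; first exact: measurableC.
    rewrite mx_lawE -[RHS](measure0 (cube_law R n)); congr (cube_law R n _).
    apply/seteqP; split => x //; rewrite /preimage /=.
    by rewrite tnth_sketch_scale_mx (negbTE iV).
  by move=> v /= nP v0; apply: nP; rewrite /P (negbTE iV); split.
have Hm (m : nat) : {ae mu, forall v, forall i : 'I_n, i = m :> nat -> P i v}.
  have [mn|nm] := ltnP m n.
    apply: filterS (H (Ordinal mn)) => v Pv i im.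
    by rewrite (_ : i = Ordinal mn)//; exact: val_inj.
  by apply: aeW => v i im; move: (ltn_ord i); rewrite im ltnNge nm.
move: (ae_foralln Hm).
apply: filterS => v Pv; split => i; first by case: (Pv i i erefl).
by case: (Pv i i erefl).
Qed.

(** After scaling, column [i] is a combination of the scaled columns [j < i] with coefficients
    [c j * eta ^+ (i - j)]. They form a matrix [N] to which [mx_law_unipotent] applies. *)
Lemma mx_law_mask (R : realType) (k n : nat) (A : 'M[R]_(k, n)) (eta g : R)
    (U W : {set 'I_n}) (E : set (k.-tuple R)) :
  0 < eta -> eta <= 1 -> 0 <= g -> W \subset U ->
  (forall i, i \in U :\: W -> exists c : 'I_n -> R,
    col i A = \sum_(j in W | (j < i)%N) c j *: col j A /\
    forall j, `|c j| <= g) ->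
  measurable E ->
  (mx_law (A *m scale_mx eta U) E
   <= mx_law (A *m scale_mx eta W) E + (n%:R * n%:R * (g * eta))%:E)%E.
Proof.
move=> eta0 eta1 g0 WU H mE.
have {H} /fin_all_exists[C HC] : forall i, exists c : 'I_n -> R,
    i \in U :\: W -> col i A = \sum_(j in W | (j < i)%N) c j *: col j A /\
    forall j, `|c j| <= g.
  move=> i; have [/H[c Hc]|] := boolP (i \in U :\: W); first by exists c.
  by exists (fun=> 0).
pose N : 'M[R]_n := \matrix_(j, i)
  (if [&& j \in W, i \in U :\: W & (j < i)%N] then C i j * eta ^+ (i - j) else 0).
have -> : A *m scale_mx eta U = (A *m scale_mx eta W) *m (1%:M + N).
  apply/matrixP => r i; rewrite mulmxDr mulmx1 [RHS]mxE !mul_mx_diag.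
  rewrite !mxE.
  have [iW|iW] := boolP (i \in W).
    rewrite (fintype.subsetP WU _ iW) big1 ?addr0// => j _.
    by rewrite !mxE inE iW /= andbF mulr0.
  rewrite mulr0 add0r.
  have [iU|iU] := boolP (i \in U); last first.
    by rewrite mulr0 big1// => j _; rewrite !mxE inE iW (negbTE iU) /= andbF mulr0.
  have iUW : i \in U :\: W by rewrite inE iW.
  have [/colP/(_ r) + _] := HC i iUW; rewrite !mxE => ->.
  rewrite summxE mulr_suml [RHS](bigID (fun j : 'I_n => (j \in W) && (j < i)%N))/=.
  rewrite [X in _ = _ + X]big1 ?addr0; last first.
    move=> j; rewrite !mxE iUW /= => /negbTE ->; exact: mulr0.
  apply: eq_bigr => j /andP[jW ji]; rewrite !mxE jW ji iUW /=.
  have -> : eta ^+ i = eta ^+ (i - j) * eta ^+ j by rewrite -exprD subnK// ltnW.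
  move: (C i j) (A r j) (eta ^+ j) (eta ^+ (i - j)) => c a x y.
  by rewrite [c * a]mulrC [y * x]mulrC mulrACA.
apply: le_trans (mx_law_unipotent (W := W) _ _ mE) _.
  move=> j i; rewrite mxE; case: ifP => [/and3P[jW + _] _|]; last by rewrite eqxx.
  by rewrite jW inE => /andP[].
apply: leeD2l; rewrite lee_fin -[n%:R * n%:R * _]mulrA.
have -> : n%:R * (n%:R * (g * eta)) = \sum_(j < n) \sum_(i < n) (g * eta).
  by rewrite !sumr_const card_ord !mulr_natl.
apply: ler_sum => j _; apply: ler_sum => i _; rewrite mxE.
case: ifP => [/and3P[_ iUW ji]|_]; last by rewrite normr0 mulr_ge0// ltW.
have [_ /(_ j) Cg] := HC i iUW.
rewrite normrM ler_pM// normrX ger0_norm ?(ltW eta0)//.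
(* Since [j < i] is strict, the exponent [i - j] is at least one, which yields the factor [eta]. *)
by rewrite -[leRHS]expr1; apply: ler_wiXn2l; rewrite ?subn_gt0// (ltW eta0).
Qed.

Lemma sketch_mulmx (R : realType) (k m n : nat) (A : 'M[R]_(k, m))
    (B : 'M[R]_(m, n)) (x : n.-tuple R) :
  sketch (A *m B) x = sketch A (sketch B x).
Proof.
apply: eq_from_tnth => i; rewrite !tnth_mktuple -mulmxA.
by congr ((A *m _) i 0); apply/colP => j; rewrite [RHS]mxE tnth_mktuple.
Qed.

Lemma sketch_law_aux_law (R : realType) (k n : nat) (A : 'M[R]_(k, n)) (eta : R)
    (M W : {set 'I_n}) (E : set (k.-tuple R)) :
  sketch_law A (aux_law eta) M W E = mx_law (A *m scale_mx eta (W :|: M)) E.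
Proof.
rewrite /sketch_law /aux_law /mx_law /= /distribution /pushforward.
congr (cube_law R n _).
by apply/seteqP; split => x; rewrite /preimage /= sketch_mulmx.
Qed.

(** * Spans of columns *)

Section ColumnSpans.
Variables (R : realType) (k n : nat) (A : 'M[R]_(k, n)).
Implicit Types (S T J : {set 'I_n}) (i j : 'I_n).

(** A row space given by a square matrix, so that the spans for all [S] share one type. *)
Definition col_span S : 'M[R]_k := (\sum_(j in S) <<row j A^T>>)%MS.

Lemma col_span_subP p (X : 'M[R]_(p, k)) S :
  reflect (forall j, j \in S -> (row j A^T <= X)%MS) (col_span S <= X)%MS.
Proof.
by apply: (iffP sumsmx_subP) => H j /H; rewrite genmxE.
Qed.

Lemma row_sub_col_span S j : j \in S -> (row j A^T <= col_span S)%MS.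
Proof. by move=> jS; apply: (sumsmx_sup j) => //; rewrite genmxE. Qed.

Lemma col_spanS S T : S \subset T -> (col_span S <= col_span T)%MS.
Proof.
move=> /fintype.subsetP ST; apply/col_span_subP => j /ST; exact: row_sub_col_span.
Qed.

Lemma col_spanU1 j S : (col_span (j |: S) :=: row j A^T + col_span S)%MS.
Proof.
apply/eqmxP/andP; split.
  apply/col_span_subP => i; rewrite !inE => /orP[/eqP->|iS].
    exact: addsmxSl.
  by rewrite (submx_trans (row_sub_col_span iS))// addsmxSr.
rewrite addsmx_sub row_sub_col_span ?finset.setU11//=.
by apply: col_spanS; exact: finset.subsetUr.
Qed.

Lemma col_spanP S i :
  (row i A^T <= col_span S)%MS ->
  exists c : 'I_n -> R, col i A = \sum_(j in S) c j *: col j A.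
Proof.
move=> /sub_sumsmxP[u uE].
have H j : exists a, u j *m <<row j A^T>>%MS = a *: row j A^T.
  by apply/sub_rVP; rewrite (submx_trans (submxMl _ _))// genmxE.
have {H} /fin_all_exists[c cE] := H.
exists c; apply: trmx_inj; rewrite tr_col uE raddf_sum.
by apply: eq_bigr => j _; rewrite cE; apply/rowP => r; rewrite !mxE.
Qed.

Lemma rank_col_span_leq S : (\rank (col_span S) <= k)%N.
Proof. exact: rank_leq_row. Qed.

Lemma rank_col_span0 : \rank (col_span finset.set0) = 0%N.
Proof. by rewrite /col_span big_set0 mxrank0. Qed.

Lemma rank_col_spanU1 j S :
  \rank (col_span (j |: S)) =
  (\rank (col_span S) + ~~ (row j A^T <= col_span S)%MS)%N.
Proof.
have [jS|jS] /= := boolP (row j A^T <= col_span S)%MS.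
  rewrite addn0; apply: eqmx_rank; apply/andP; split; last first.
    by apply: col_spanS; exact: finset.subsetUr.
  by rewrite col_spanU1 addsmx_sub jS /=.
apply/eqP; rewrite eqn_leq; apply/andP; split.
  rewrite col_spanU1 addnC; apply: (leq_trans (mxrank_adds_leqif _ _)).
  by rewrite leq_add2r rank_leq_row.
rewrite addn1 ltn_neqAle mxrankS ?andbT; last first.
  by apply: col_spanS; exact: finset.subsetUr.
apply: contraNneq jS => rE.
have := mxrank_leqif_sup (col_spanS (finset.subsetUr [set j]%SET S)).
move=> [_]; rewrite rE eqxx => /esym; apply: submx_trans.
by apply: row_sub_col_span; exact: finset.setU11.
Qed.

Definition col_indep S := \rank (col_span S) == #|S|.

(** A maximal independent set between [J] and [T] spans [T], since any column outside its span could
    be added. *)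
Lemma col_indep_extend J T : col_indep J -> J \subset T ->
  exists B : {set 'I_n}, [/\ J \subset B, B \subset T, col_indep B &
    (col_span T <= col_span B)%MS].
Proof.
move=> indJ JT; pose P (X : {set 'I_n}) := (X \subset T) && col_indep X.
have PJ : P J by rewrite /P JT.
have [B /maxsetP[/andP[BT indB] maxB] JB] := maxset_exists PJ.
exists B; split => //; apply/col_span_subP => t tT.
apply/negPn/negP => tB.
have tnB : t \notin B by apply: contra tB; exact: row_sub_col_span.
have : P (t |: B).
  rewrite /P finset.subUset finset.sub1set tT BT /= /col_indep rank_col_spanU1 tB.
  by rewrite cardsU1 tnB (eqP indB) addnC.
move=> /maxB /(_ (finset.subsetUr _ _)) BE.
by move: tnB; rewrite -BE finset.setU11.
Qed.

(** A basis [J] of the span of [S] extends to a basis [B] of the column space. The coefficients of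
    column [i] over [J] are then entries of [F *m A], with [F] a basis change for [B]. Using
    [|gamma|] also covers the zero coefficients outside [J], whatever the sign of [gamma]. *)
Lemma col_spanP_bounded S i (gamma : R) :
  (gamma0 A <= gamma%:E)%E -> (row i A^T <= col_span S)%MS ->
  exists c : 'I_n -> R, col i A = \sum_(j in S) c j *: col j A /\
    forall j, `|c j| <= `|gamma|.
Proof.
move=> Ag iS.
have ind0 : col_indep finset.set0 by rewrite /col_indep rank_col_span0 cards0.
have [J [_ JS indJ SJ]] := col_indep_extend ind0 (finset.sub0set S).
have [B [JB _ indB TB]] := col_indep_extend indJ (finset.subsetT J).
have [c cE] := col_spanP (submx_trans iS SJ).
pose b : #|B|.-tuple 'I_n := [tuple enum_val p | p < #|B|].
pose G : 'M[R]_(#|B|, k) := (colsub (tnth b) A)^T.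
have rowG p : row p G = row (enum_val p) A^T.
  by apply/rowP => r; rewrite !mxE tnth_mktuple.
have GB : (G :=: col_span B)%MS.
  apply/eqmxP/andP; split.
    by apply/row_subP => p; rewrite rowG row_sub_col_span// enum_valP.
  apply/col_span_subP => j jB; rewrite -(enum_rankK_in jB jB) -rowG.
  exact: row_sub.
have freeG : row_free G by rewrite /row_free GB.
have lk : (#|B| <= k)%N by rewrite -(eqP indB) rank_leq_row.
have GpidE : G *m (pinvmx G *m pid_mx #|B|) = (pid_mx #|B| : 'M[R]_(#|B|, k)).
  by rewrite mulmxA mulmxVp// mul1mx.
(* [pinvmx G *m pid_mx #|B|] sends the rows of [G] to unit vectors but may be singular. It preserves
   the rank of [G], so some invertible [g] agrees with it on these rows. *)
have [g gu gE] := @complete_unitmx _ _ _ G (pinvmx G *m pid_mx #|B|)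
   (etrans (congr1 _ GpidE) (etrans (rank_pid_mx _ (leqnn _) lk) (esym (eqP freeG)))).
pose F := g^T.
have colF j (jB : j \in B) : F *m col j A =
    \col_(r < k) (r == enum_rank_in jB j :> nat)%:R.
  apply: trmx_inj; rewrite trmx_mul trmxK tr_col.
  rewrite -{1}(enum_rankK_in jB jB) -rowG -row_mul -gE GpidE.
  by apply/rowP => r; rewrite !mxE ltn_ord andbT eq_sym.
have Fmem : is_column_basis A b /\ is_basis_change A b F.
  split; split => //; last first.
  - move=> p; have pB := enum_valP p.
    by rewrite tnth_mktuple (colF _ pB) enum_valK_in.
  - by rewrite unitmx_tr.
  apply/row_subP => j; apply: (@submx_trans _ _ _ _ _ _ (col_span [set: 'I_n])).
    by apply: row_sub_col_span; rewrite finset.in_setT.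
  by rewrite (submx_trans TB)// GB.
have Fle r j : `|(F *m A) r j| <= gamma.
  rewrite -lee_fin; apply: le_trans Ag; apply: ereal_sup_ubound.
  by exists #|B|, b, F, r, j; case: Fmem.
have FAE r : (F *m A) r i = \sum_(j in J) c j * (F *m col j A) r 0.
  transitivity ((F *m col i A) r 0).
    by rewrite !mxE; apply: eq_bigr => l _; rewrite !mxE.
  rewrite cE mulmx_sumr summxE; apply: eq_bigr => j _.
  by rewrite -scalemxAr mxE.
exists (fun j => if j \in J then c j else 0); split.
  rewrite cE [RHS](bigID (fun j => j \in J)) /= [X in _ = _ + X]big1 ?addr0; last first.
    by move=> j /andP[_ /negbTE ->]; rewrite scale0r.
  apply: eq_big => [j|j jJ]; last by rewrite jJ.
  by case jJ: (j \in J); rewrite ?andbF// (fintype.subsetP JS).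
move=> j; case: ifP => [jJ|_]; last by rewrite normr0.
have jB := fintype.subsetP JB _ jJ.
(* [F] sends column [j] to the unit vector at its position [p] in [B], so coordinate [p] of the
   image of column [i] is [c j]. *)
pose p := widen_ord lk (enum_rank_in jB j).
suff <- : (F *m A) p i = c j by apply: le_trans (Fle _ _) (ler_norm _).
rewrite FAE (bigD1 j)//= big1 ?addr0 ?(colF _ jB) ?mxE ?eqxx ?mulr1//.
move=> j' /andP[j'J j'j]; have j'B := fintype.subsetP JB _ j'J.
rewrite (colF _ j'B) mxE /=; case: eqP => [e|]; last by rewrite mulr0.
case/negP: j'j; rewrite -(enum_rankK_in jB jB) -(enum_rankK_in j'B j'B).
by rewrite eq_sym; apply/eqP; congr enum_val; apply: val_inj.
Qed.

End ColumnSpans.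

(** * Bernoulli sampling and greedy bases *)

Section BernoulliMean.
Variables (R : realType) (n : nat) (q : R).
Hypotheses (q0 : 0 <= q) (q1 : q <= 1).
Implicit Types (U P C X Y : {set 'I_n}) (f g : {set 'I_n} -> R).

Definition bern_mean f : R := \sum_(U : {set 'I_n}) bern_weight q U * f U.

Lemma bern_weight_ge0 U : 0 <= bern_weight q U.
Proof. by apply: prodr_ge0 => i _; case: ifP => _; rewrite ?subr_ge0. Qed.

Lemma bern_mean_cst c : bern_mean (fun=> c) = c.
Proof.
rewrite /bern_mean -mulr_suml (_ : \sum_U _ = 1) ?mul1r//.
transitivity (\prod_(i < n) (q + (1 - q))).
  rewrite bigA_distr; apply: eq_big => [U|U _]; first by rewrite inE.
  rewrite /bern_weight; apply: eq_bigr => i _.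
  by [].
by rewrite big1// => i _; rewrite addrC subrK.
Qed.

Lemma bern_meanD f g : bern_mean (fun U => f U + g U) = bern_mean f + bern_mean g.
Proof. by rewrite /bern_mean -big_split; apply: eq_bigr => U _; rewrite mulrDr. Qed.

Lemma bern_meanZ c f : bern_mean (fun U => c * f U) = c * bern_mean f.
Proof. by rewrite /bern_mean mulr_sumr; apply: eq_bigr => U _; rewrite mulrCA. Qed.

Lemma bern_mean_sum (I : Type) (s : seq I) (r : pred I) (F : I -> {set 'I_n} -> R) :
  bern_mean (fun U => \sum_(i <- s | r i) F i U) = \sum_(i <- s | r i) bern_mean (F i).
Proof.
rewrite /bern_mean exchange_big /=; apply: eq_bigr => U _; by rewrite mulr_sumr.
Qed.

Lemma ler_bern_mean f g : (forall U, f U <= g U) -> bern_mean f <= bern_mean g.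
Proof. by move=> fg; apply: ler_sum => U _; rewrite ler_wpM2l ?bern_weight_ge0. Qed.

Lemma eq_bern_mean f g : f =1 g -> bern_mean f = bern_mean g.
Proof. by move=> fg; apply: eq_bigr => U _; rewrite fg. Qed.

Lemma bern_mean_split (c : 'I_n) f :
  bern_mean f = \sum_(U : {set 'I_n} | c \notin U)
    (\prod_(i | i != c) (if i \in U then q else 1 - q)) *
    (q * f (c |: U)%SET + (1 - q) * f U).
Proof.
rewrite /bern_mean (bigID (fun U : {set 'I_n} => c \in U)) /=.
rewrite (reindex_onto (fun U : {set 'I_n} => c |: U)%SET (fun U => U :\ c)%SET) /=; last first.
  by move=> U cU; rewrite finset.setD1K.
rewrite (eq_bigl (fun U : {set 'I_n} => c \notin U)) => [|U]; last first.
  rewrite finset.setU11 /=; apply/eqP/idP => [<-|cU]; first by rewrite !inE eqxx.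
  by rewrite finset.setU1K.
rewrite -big_split /=; apply: eq_bigr => U cU.
rewrite mulrDr !mulrA /bern_weight.
rewrite (bigD1 c)//= finset.setU11 [X in _ + X * _](bigD1 c)//= (negbTE cU).
congr (_ * _ + _ * _); rewrite mulrC; congr (_ * _).
by apply: eq_bigr => i ic; rewrite !inE (negbTE ic).
Qed.

(** Whether [c] is sampled is independent of the other indices, so it may be drawn afresh. *)
Lemma bern_mean_resample (c : 'I_n) f :
  bern_mean f = bern_mean (fun U => q * f (c |: U)%SET + (1 - q) * f (U :\ c)%SET).
Proof.
rewrite (bern_mean_split c f) (bern_mean_split c (fun U => _ + _)).
apply: eq_bigr => U cU; congr (_ * _).
rewrite finset.setUA finset.setUid finset.setU1K// (_ : U :\ c = U)%SET; first by ring.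
by apply/setP => i; rewrite !inE; case: eqVneq => [->|//]; rewrite (negbTE cU).
Qed.

(** Add the elements of [C] one by one. Each contributes on average [q] times its marginal gain over
    the sample, which by diminishing returns is at least its gain over the larger set containing all
    previous elements of [C]; the latter gains telescope. *)
Lemma submodular_sampling f :
  (forall c X Y, X \subset Y -> f (c |: Y)%SET - f Y <= f (c |: X)%SET - f X) ->
  forall P C, {in C, forall c, c \notin P} ->
  bern_mean (fun U => (1 - q) * f (U :&: P)%SET + q * f (U :&: P :|: C)%SET)
  <= bern_mean (fun U => f (U :&: (P :|: C))%SET).
Proof.
move=> subm P C; move: {2}#|C| (erefl #|C|) => m.
elim: m C => [|m IHm] C Cm PC.
  move/eqP: Cm; rewrite cards_eq0 => /eqP ->; apply: ler_bern_mean => U.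
  by rewrite !finset.setU0 -mulrDl subrK mul1r.
have [c cC] : exists c, c \in C by apply/card_gt0P; rewrite Cm.
pose C0 := (C :\ c)%SET.
have CE : C = (c |: C0)%SET by rewrite /C0 finset.setD1K.
have cC0 : c \notin C0 by rewrite !inE eqxx.
have cP : c \notin P by exact: PC.
have PC0 : {in C0, forall c, c \notin P} by move=> c'; rewrite inE => /andP[_ /PC].
have C0m : #|C0| = m by move: Cm; rewrite (cardsD1 c) cC => -[].
have IH := IHm C0 C0m PC0.
rewrite [leRHS](bern_mean_resample c).
rewrite [leRHS](eq_bern_mean (g := fun U => f (U :&: (P :|: C0))%SET +
   q * (f (c |: (U :&: (P :|: C0)))%SET - f (U :&: (P :|: C0))%SET))); last first.
  move=> U.
  have -> : ((c |: U) :&: (P :|: C) = c |: (U :&: (P :|: C0)))%SET.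
    apply/setP => i; rewrite CE !inE; case: eqVneq => [->|//]; by rewrite orbT.
  have -> : ((U :\ c) :&: (P :|: C) = U :&: (P :|: C0))%SET.
    apply/setP => i; rewrite CE !inE; case: eqVneq => [->|//].
    by rewrite (negbTE cP) ?andbF.
  by ring.
rewrite bern_meanD bern_meanZ.
have subU U : f (c |: (U :&: P :|: C0))%SET - f (U :&: P :|: C0)%SET <=
    f (c |: (U :&: (P :|: C0)))%SET - f (U :&: (P :|: C0))%SET.
  by apply: subm; rewrite finset.setIUr finset.setUS// finset.subsetIr.
apply: le_trans (lerD IH (ler_wpM2l q0 (ler_bern_mean subU))).
rewrite -bern_meanZ -bern_meanD; apply: ler_bern_mean => U.
rewrite (_ : c |: (U :&: P :|: C0) = U :&: P :|: C)%SET; first by lra.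
by rewrite finset.setUCA -CE.
Qed.

End BernoulliMean.

Section GreedyLayers.
Variables (R : realType) (k n : nat) (A : 'M[R]_(k, n)).
Implicit Types (S T U : {set 'I_n}) (i j b : 'I_n).

Definition before S (m : nat) : {set 'I_n} := [set j in S | (j < m)%N]%SET.

Lemma in_before S m j : (j \in before S m) = (j \in S) && (j < m)%N.
Proof. by rewrite inE. Qed.

Definition greedy S : {set 'I_n} :=
  [set i in S | ~~ (row i A^T <= col_span A (before S i))%MS]%SET.

Lemma beforeS S T m p : S \subset T -> (m <= p)%N -> before S m \subset before T p.
Proof.
move=> /fintype.subsetP ST mp; apply/fintype.subsetP => j.
by rewrite !inE => /andP[/ST -> /= jm]; exact: leq_trans jm mp.
Qed.

Lemma greedy_sub S : greedy S \subset S.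
Proof. by apply/fintype.subsetP => i; rewrite inE => /andP[]. Qed.

(** Strong induction: a column not chosen is spanned by earlier columns of [S], each of which is
    spanned by chosen ones up to its own index. The cut [i.+1] admits [i] itself. *)
Lemma greedy_span S i : i \in S ->
  (row i A^T <= col_span A (before (greedy S) i.+1))%MS.
Proof.
have [m] := ubnP (val i); elim: m i => // m IHm i im iS.
have [ig|] := boolP (i \in greedy S).
  by apply: row_sub_col_span; rewrite inE ig /=.
rewrite inE iS /= negbK => /submx_trans; apply; apply/col_span_subP => j.
rewrite inE => /andP[jS ji].
apply: submx_trans (IHm j _ jS) _; first exact: leq_trans ji im.
by apply: col_spanS; apply: beforeS => //; exact: ltnW.
Qed.

(** Each chosen column raises the rank of the prefix of chosen columns, and the rank is at most
    [k]. *)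
Lemma card_greedy S : (#|greedy S| <= k)%N.
Proof.
suff H m : (m <= n)%N ->
    (#|before (greedy S) m| <= \rank (col_span A (before (greedy S) m)))%N.
  apply: leq_trans (leq_trans (H n (leqnn n)) (rank_col_span_leq A _)).
  by apply: subset_leq_card; apply/fintype.subsetP => j jS; rewrite inE jS /=.
elim: m => [|m IHm] mn.
  by rewrite (_ : before _ 0 = finset.set0) ?cards0//; apply/setP => j; rewrite !inE andbF.
pose i := Ordinal mn.
have IH := IHm (ltnW mn).
have [ig|ig] := boolP (i \in greedy S); last first.
  rewrite (_ : before _ m.+1 = before (greedy S) m)//.
  apply/setP => j; rewrite !in_before ltnS leq_eqVlt.
  have [jm|//] := eqVneq (j : nat) m.
  by rewrite (_ : j = i) ?(negbTE ig)//; exact: val_inj.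
have -> : before (greedy S) m.+1 = (i |: before (greedy S) m)%SET.
  apply/setP => j; rewrite finset.in_setU1 !in_before ltnS leq_eqVlt.
  have [jm|jm] := eqVneq (j : nat) m; last first.
    by rewrite (_ : (j == i) = false)//; apply: contra_neqF jm => /eqP ->.
  by rewrite (_ : j = i) ?ig ?eqxx//; exact: val_inj.
rewrite cardsU1 rank_col_spanU1 addnC; apply: leq_add => //.
rewrite inE ltnn andbF /=.
suff -> : (row i A^T <= col_span A (before (greedy S) m))%MS = false by [].
apply/negbTE; move: ig; rewrite inE => /andP[_]; apply: contra => /submx_trans; apply.
by apply: col_spanS; apply: beforeS => //; exact: greedy_sub.
Qed.

Fixpoint rest (t : nat) : {set 'I_n} :=
  if t is t'.+1 then (rest t' :\: greedy (rest t'))%SET else finset.setT.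

Definition layer t := greedy (rest t).

(** The union of the layers [0] to [t - 1]; [layer t] is the first layer outside it. *)
Definition pool t : {set 'I_n} := (~: rest t)%SET.

Lemma poolS t : pool t.+1 = (pool t :|: layer t)%SET.
Proof. by rewrite /pool /= finset.setCD. Qed.

Lemma card_pool t : (#|pool t| <= k * t)%N.
Proof.
elim: t => [|t IHt]; first by rewrite /pool /= finset.setCT cards0.
by rewrite poolS mulnS addnC (leq_trans (leq_card_setU _ _))// leq_add// card_greedy.
Qed.

(** The columns of [layer t.+1] were available when [layer t] was chosen, so [greedy_span] applies
    to them. *)
Lemma layer_span t b :
  (col_span A (before (layer t.+1) b.+1) <= col_span A (before (layer t) b.+1))%MS.
Proof.
apply/col_span_subP => j; rewrite inE => /andP[jl jb].
have := fintype.subsetP (greedy_sub _) _ jl; rewrite /= inE => /andP[_ jr].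
by apply: submx_trans (greedy_span jr) _; apply: col_spanS; exact: beforeS.
Qed.

Definition rk S : R := (\rank (col_span A S))%:R.

(** Both gains are [0] or [1], and a column outside the span of [T] is outside that of [S]. *)
Lemma rk_submodular j S T : S \subset T ->
  rk (j |: T)%SET - rk T <= rk (j |: S)%SET - rk S.
Proof.
move=> ST; rewrite /rk !rank_col_spanU1 !natrD.
rewrite [leLHS]addrAC [leRHS]addrAC !subrr !add0r ler_nat.
case: (boolP (row j A^T <= col_span A S)%MS) => //= jS; last by case: (~~ _).
by rewrite (submx_trans jS (col_spanS _ ST)).
Qed.

Lemma rk_le S T : (col_span A S <= col_span A T)%MS -> rk S <= rk T.
Proof. by move=> ST; rewrite /rk ler_nat mxrankS. Qed.

Definition deficiency t b U : R :=
  rk (U :&: before (pool t) b.+1 :|: before (layer t) b.+1)%SET -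
  rk (U :&: before (pool t) b.+1)%SET.

Lemma col_spanU S T : (col_span A (S :|: T) :=: col_span A S + col_span A T)%MS.
Proof.
apply/eqmxP/andP; split.
  apply/col_span_subP => j; rewrite inE => /orP[jS|jT].
    by rewrite (submx_trans (row_sub_col_span A jS))// addsmxSl.
  by rewrite (submx_trans (row_sub_col_span A jT))// addsmxSr.
by rewrite addsmx_sub !col_spanS ?finset.subsetUl ?finset.subsetUr.
Qed.

(** Let [P] and [C] be the pool and its next layer, cut after [b]. The following layer adds nothing
    to the span of [C], so the new deficiency is at most the rank of [U :&: P :|: C] minus that of
    [U :&: (P :|: C)]; [submodular_sampling] bounds its mean by [1 - q] times the old one. *)
Lemma bern_mean_deficiency (q : R) t b : 0 <= q -> q <= 1 ->
  bern_mean q (deficiency t b) <= (1 - q) ^+ t * k%:R.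
Proof.
move=> q0 q1; elim: t => [|t IHt].
  rewrite expr0 mul1r -[leRHS](bern_mean_cst n q); apply: ler_bern_mean => // U.
  rewrite /deficiency lerBlDr (le_trans (y := k%:R))//.
    by rewrite /rk ler_nat rank_col_span_leq.
  by rewrite lerDl /rk.
rewrite exprS -mulrA; apply: le_trans (ler_wpM2l _ IHt); last by rewrite subr_ge0.
pose P := before (pool t) b.+1; pose C := before (layer t) b.+1.
have PC : (P :|: C)%SET = before (pool t.+1) b.+1.
  by apply/setP => j; rewrite poolS !inE andb_orl.
have CP : {in C, forall c, c \notin P}.
  move=> c; rewrite inE => /andP[cl _]; rewrite !inE negb_and negbK.
  by rewrite (fintype.subsetP (greedy_sub _) _ cl).
have samp := submodular_sampling q0 q1 (f := rk)
  (fun c X Y XY => rk_submodular c XY) CP.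
pose f1 U := rk (U :&: P)%SET; pose f2 U := rk (U :&: P :|: C)%SET.
pose f3 U := rk (U :&: (P :|: C))%SET.
have le3 U : deficiency t.+1 b U <= f2 U + (-1) * f3 U.
  rewrite /deficiency -PC /f2 /f3 mulN1r lerD2r; apply: rk_le.
  rewrite col_spanU addsmx_sub; apply/andP; split.
    apply: col_spanS; apply/fintype.subsetP => j; rewrite !inE.
    by case: (j \in U) => //= ->.
  apply: submx_trans (layer_span _ _) _.
  by apply: col_spanS; exact: finset.subsetUr.
apply: le_trans (ler_bern_mean q0 q1 le3) _.
rewrite bern_meanD bern_meanZ.
have -> : bern_mean q (deficiency t b) = bern_mean q f2 + (-1) * bern_mean q f1.
  by rewrite -bern_meanZ -bern_meanD; apply: eq_bern_mean => U; rewrite mulN1r.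
have : (1 - q) * bern_mean q f1 + q * bern_mean q f2 <= bern_mean q f3.
  by rewrite -!bern_meanZ -bern_meanD.
lra.
Qed.

Lemma deficiency_ge0 t b U : 0 <= deficiency t b U.
Proof. by rewrite subr_ge0; apply/rk_le/col_spanS; exact: finset.subsetUl. Qed.

(** Turns the bound on the mean deficiency into one on the probability that [b] is missed. The cut
    at [b.+1] matters, as it retains [b] in the layer. *)
Lemma deficiency_ge1 t b U : b \in layer t ->
  ~~ (row b A^T <= col_span A (U :&: before (pool t) b.+1)%SET)%MS ->
  1 <= deficiency t b U.
Proof.
move=> bl bU; set X := (U :&: _)%SET in bU *.
have : rk (b |: X)%SET - rk X <= deficiency t b U.
  rewrite lerD2r; apply/rk_le/col_spanS/fintype.subsetP => j.
  rewrite finset.in_setU1 finset.in_setU in_before.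
  by move=> /orP[/eqP ->|->//]; rewrite bl ltnS leqnn orbT.
by apply: le_trans; rewrite /rk rank_col_spanU1 bU natrD addrAC subrr add0r.
Qed.

(* The union bound is over the columns [b] of the first layer outside the pool
   only: their spans, cut at [b], span every column outside the pool. *)
Lemma pool_spans t U :
  (forall b, b \in layer t ->
     (row b A^T <= col_span A (U :&: before (pool t) b.+1)%SET)%MS) ->
  forall i, i \notin pool t -> (row i A^T <= col_span A (before (U :&: pool t) i))%MS.
Proof.
move=> H i iL; have iR : i \in rest t by move: iL; rewrite inE negbK.
apply: submx_trans (greedy_span iR) _; apply/col_span_subP => b.
rewrite inE => /andP[bl bi]; apply: submx_trans (H b bl) _.
apply: col_spanS; apply/fintype.subsetP => j; rewrite !inE.
(* Here [j <= b <= i], and [j] differs from [i] because only [j] is in the pool; masking needs this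
   strict inequality. *)
move=> /and3P[jU jL jb]; rewrite jU jL /= ltn_neqAle.
rewrite (leq_trans (n := b))// andbT; apply: contraNneq iL => ji.
by rewrite (_ : i = j) ?inE//; exact/esym/val_inj.
Qed.

End GreedyLayers.

(** * Determining pools from masking *)

Lemma tv_sketch_law_mask (R : realType) (k n : nat) (A : 'M[R]_(k, n))
    (gamma eta : R) (M1 W1 M2 W2 : {set 'I_n}) :
  (gamma0 A <= gamma%:E)%E -> 0 < eta -> eta <= 1 ->
  W2 :|: M2 \subset W1 :|: M1 ->
  (forall i, i \in W1 :|: M1 -> i \notin W2 :|: M2 ->
     (row i A^T <= col_span A (before (W2 :|: M2) i))%MS) ->
  tv_dist (sketch_law A (aux_law eta) M1 W1) (sketch_law A (aux_law eta) M2 W2)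
  <= n%:R * n%:R * (`|gamma| * eta).
Proof.
move=> Ag eta0 eta1 sub span; apply: tv_dist_le => E mE.
rewrite !sketch_law_aux_law; apply: mx_law_mask => // i.
rewrite inE => /andP[iW iU]; have [c [cE cg]] := col_spanP_bounded Ag (span i iU iW).
exists c; split => //; rewrite cE; apply: eq_bigl => j.
by rewrite in_before.
Qed.

(** [D'] is the sketch law of the query restricted to the pool. If the sampled pool spans the next
    layer, every column outside is masked, for all [M] at once, since [M] only enlarges the span. *)
Lemma determining_pool_pool (R : realType) (k n : nat) (A : 'M[R]_(k, n))
    (gamma eta qmin qmax delta : R) (t : nat) :
  (gamma0 A <= gamma%:E)%E -> 0 < eta -> eta <= 1 -> 0 < qmin -> qmax < 1 ->
  k%:R * ((1 - qmin) ^+ t * k%:R) + n%:R * n%:R * (`|gamma| * eta) <= delta ->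
  determining_pool A (aux_law eta) qmin qmax delta (pool A t).
Proof.
move=> Ag eta0 eta1 qmin0 qmax1 le_delta.
set eps := n%:R * n%:R * (`|gamma| * eta) in le_delta.
have eps0 : 0 <= eps by rewrite !mulr_ge0// ltW.
exists (sketch_law A (aux_law eta)) => M q ML /andP[qminq qqmax].
have q0 : 0 <= q by apply: le_trans qminq; exact: ltW.
have q1 : q <= 1 by apply: le_trans qqmax _; exact: ltW.
apply: le_trans le_delta.
pose bound U := \sum_(b in layer A t) deficiency A t b U + eps.
apply: (@le_trans _ _ (bern_mean q bound)).
  apply: ler_bern_mean => // U; rewrite /bound.
  have [/forallP good|] := boolP [forall b, (b \in layer A t) ==>
      (row b A^T <= col_span A (U :&: before (pool A t) b.+1)%SET)%MS].
    apply: (@le_trans _ _ eps); last first.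
      by rewrite lerDr; apply: sumr_ge0 => b _; exact: deficiency_ge0.
    apply: tv_sketch_law_mask => //.
      apply/fintype.subsetP => i; rewrite !inE.
      by case: (i \in M); rewrite ?orbT ?orbF //= => /andP[].
    move=> i; rewrite !inE negb_or => iUM /andP[]; case: (i \in M) iUM => //=.
    rewrite orbF => iU; rewrite iU /= => iL _.
    apply: submx_trans (pool_spans (U := U) _ _) _.
    - by move=> b bl; have /implyP := good b; apply.
    - by rewrite inE.
    apply/col_spanS/beforeS => //; apply/fintype.subsetP => j; rewrite !inE.
    by case: (j \in M) => /=; rewrite ?orbT ?orbF.
  rewrite negb_forall => /existsP[b]; rewrite negb_imply => /andP[bl bU].
  (* A missed [b] costs at most [1], which its own deficiency pays for. *)
  apply: (le_trans (tv_dist_le1 _ _)); rewrite -[leLHS]addr0 lerD//.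
  rewrite (bigD1 b)//= -[leLHS]addr0 lerD//; first exact: deficiency_ge1.
  by apply: sumr_ge0 => b' _; exact: deficiency_ge0.
rewrite /bound bern_meanD bern_mean_cst bern_mean_sum lerD2r.
apply: (@le_trans _ _ (\sum_(b in layer A t) (1 - qmin) ^+ t * k%:R)).
  apply: ler_sum => b _; apply: (le_trans (bern_mean_deficiency _ _ _ q0 q1)).
  by rewrite ler_wpM2r// lerXn2r ?nnegrE ?subr_ge0// ?lerD2l ?lerN2// (le_trans qminq).
rewrite sumr_const -[leLHS]mulr_natl ler_wpM2r ?ler_nat ?card_greedy//.
by rewrite mulr_ge0// exprn_ge0// subr_ge0 (le_trans qminq).
Qed.

(** With one row, [layer A 0] has at most one column. [D'] is the law of the query supported on that
    layer; the comparison fails only if its column is not sampled, with probability [1 - q]. *)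
Lemma determining_pool_set0 (R : realType) (n : nat) (A : 'M[R]_(1, n))
    (gamma eta qmin qmax delta : R) :
  (gamma0 A <= gamma%:E)%E -> 0 < eta -> eta <= 1 -> 0 < qmin -> qmax < 1 ->
  1 - qmin + n%:R * n%:R * (`|gamma| * eta) <= delta ->
  determining_pool A (aux_law eta) qmin qmax delta finset.set0.
Proof.
move=> Ag eta0 eta1 qmin0 qmax1 le_delta.
set eps := n%:R * n%:R * (`|gamma| * eta) in le_delta.
have eps0 : 0 <= eps by rewrite !mulr_ge0// ltW.
exists (fun _ _ => sketch_law A (aux_law eta) finset.set0 (layer A 0)) => M q.
rewrite finset.subset0 => /eqP -> /andP[qminq qqmax].
have q0 : 0 <= q by apply: le_trans qminq; exact: ltW.
have q1 : q <= 1 by apply: le_trans qqmax _; exact: ltW.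
apply: le_trans le_delta.
pose bound (U : {set 'I_n}) := \sum_(b in layer A 0) (b \notin U)%:R + eps.
apply: (@le_trans _ _ (bern_mean q bound)).
  apply: ler_bern_mean => // U; rewrite /bound finset.setD0.
  have [LU|/subsetPn[b bl bU]] := boolP (layer A 0 \subset U).
    apply: (@le_trans _ _ eps); last by rewrite lerDr sumr_ge0.
    apply: tv_sketch_law_mask => //; first by rewrite !finset.setU0.
    rewrite !finset.setU0 => i _ iL.
    apply: submx_trans (greedy_span A (finset.in_setT i)) _.
    apply/col_spanS/fintype.subsetP => j; rewrite !in_before ltnS leq_eqVlt.
    move=> /andP[jL] /orP[/eqP ji|-> /=]; last by rewrite andbT.
    by case/negP: iL; rewrite (_ : i = j)//; exact/esym/val_inj.
  apply: (le_trans (tv_dist_le1 _ _)); rewrite -[leLHS]addr0 lerD//.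
  by rewrite (bigD1 b)//= bU lerDl sumr_ge0.
rewrite /bound bern_meanD bern_mean_cst bern_mean_sum lerD2r.
apply: (@le_trans _ _ (\sum_(b in layer A 0) (1 - q))).
  apply: ler_sum => b _; rewrite (bern_mean_resample q b).
  rewrite -[leRHS](bern_mean_cst n q); apply: ler_bern_mean => // U.
  by rewrite !inE eqxx /= mulr0 add0r mulr1.
have q1' : 0 <= 1 - q by rewrite subr_ge0.
apply: (@le_trans _ _ (1 - q)); last by rewrite lerD2l lerN2.
by rewrite sumr_const -[leLHS]mulr_natl ler_piMl// (ler_nat _ _ 1%N) card_greedy.
Qed.

Theorem mainTheorem9 (R : realType) (qmin : R) (hqmin : 0 < qmin) :
  exists C : R, forall (qmax delta gamma : R) (k n : nat),
    qmin <= qmax -> qmax < 1 -> 0 < delta -> delta < 1 -> (0 < k)%N ->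
    exists Aux : {set 'I_n} -> {set 'I_n} -> probability (n.-tuple R) R,
      valid_aux Aux /\
      forall A : 'M[R]_(k, n), (gamma0 A <= gamma%:E)%E ->
        exists L : {set 'I_n},
          determining_pool A Aux qmin qmax delta L /\
          #|L|%:R <= C * (k%:R * ln (k%:R / delta)).
Proof.
(* The least value of [ln (k / delta)] for which a nonempty pool is used; dividing by it absorbs
   additive constants into the logarithm. *)
pose x0 : R := ln (1 - qmin / 2)^-1.
exists ((ln 2 / x0 + 2) / qmin + x0^-1).
move=> qmax delta gamma k n qq qmax1 d0 d1 k0.
have qmin1 : qmin < 1 by exact: le_lt_trans qq qmax1.
have s0 : 0 < 1 - qmin / 2 by lra.
have x00 : 0 < x0 by rewrite ln_gt0// invf_gt1//; lra.
have ln20 : 0 <= ln 2 :> R by rewrite ln_ge0// ler1n.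
have kR0 : 0 < k%:R :> R by rewrite ltr0n.
(* The added [1] keeps the divisor of [eta] positive. With this [eta] the masking error is at most
   [delta * qmin / 2], hence below both [delta / 2] and [qmin / 2], as the two cases require. *)
pose D : R := n%:R * n%:R * `|gamma| + 1.
have D1 : 1 <= D by rewrite lerDr !mulr_ge0.
have D0 : 0 < D by exact: lt_le_trans D1.
pose eta := delta * qmin / 2 / D.
have dq0 : 0 < delta * qmin / 2 by rewrite !mulr_gt0.
have dq1 : delta * qmin / 2 <= delta / 2 by rewrite ler_pM2r ?invr_gt0// ler_piMr// ltW.
have dq2 : delta * qmin / 2 <= qmin / 2 by rewrite ler_pM2r ?invr_gt0// ler_piMl// ltW.
have eta0 : 0 < eta by rewrite divr_gt0.
have eta1 : eta <= 1 by rewrite ler_pdivrMr// mul1r; lra.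
have epsle : n%:R * n%:R * (`|gamma| * eta) <= delta * qmin / 2.
  rewrite mulrA /eta mulrA ler_pdivrMr// mulrC ler_pM2l//.
  by rewrite lerDl.
exists (aux_law eta); split; first exact: valid_aux_law.
move=> A Ag.
have [small|large] := ltP (k%:R / delta) (1 - qmin / 2)^-1.
  have kd : k%:R * (1 - qmin / 2) < delta.
    by rewrite -ltr_pdivlMr// mulrC -ltr_pdivrMr.
  (* [1 - qmin / 2] exceeds [1 / 2] and [delta] is below [1], so [k] is below [2]. *)
  have k1 : k = 1%N.
    apply/eqP; rewrite eqn_leq k0 andbT leqNgt; apply/negP => k2.
    have : (2 : R) <= k%:R by rewrite ler_nat.
    nra.
  subst k; rewrite mul1r in kd.
  exists finset.set0; split.
    by apply: (determining_pool_set0 Ag) => //; lra.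
  rewrite cards0 mul1r mulr_ge0//.
    apply: addr_ge0; last by rewrite invr_ge0 ltW.
    by apply: divr_ge0; [apply: addr_ge0 => //; apply: divr_ge0|]; rewrite // ltW.
  by rewrite ln_ge0// mul1r ltW// invf_gt1.
set x := ln (k%:R / delta).
have kd0 : 0 < k%:R / delta by rewrite divr_gt0.
have x0x : x0 <= x by rewrite /x0 /x ler_ln ?posrE// invr_gt0.
pose y := (ln 2 + 2 * x) / qmin.
have y0 : 0 <= y 
  by apply: divr_ge0; [apply: addr_ge0 => //; lra|exact: ltW].
pose t := (Num.truncn y).+1.
have yt : y < t%:R by exact: truncnS_gt.
have ty : t%:R <= y + 1 by rewrite -natr1 lerD2r truncn_le.
exists (pool A t); split.
  apply: (determining_pool_pool Ag) => //.
  have tail : (1 - qmin) ^+ t <= (2 * (k%:R / delta) ^+ 2)^-1.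
    apply: (@le_trans _ _ (expR (- qmin) ^+ t)).
      by rewrite lerXn2r ?nnegrE ?expR_ge0 ?subr_ge0 ?(ltW qmin1)// expR_ge1Dx.
    have sq0 : 0 < (k%:R / delta) ^+ 2 by exact: exprn_gt0.
    have sq20 : 0 < 2 * (k%:R / delta) ^+ 2 by exact: mulr_gt0.
    rewrite -expRM_natr -[leRHS]lnK ?posrE ?invr_gt0// ler_expR lnV ?posrE//.
    rewrite mulNr lerN2 lnM ?posrE// lnXn// -/x -[x *+ 2]mulr_natl.
    by rewrite [leRHS]mulrC -ler_pdivrMr// ltW.
  have missed : k%:R * ((1 - qmin) ^+ t * k%:R) <= delta ^+ 2 / 2.
    rewrite mulrCA -expr2; apply: (le_trans (ler_wpM2r _ tail)).
      exact: exprn_ge0.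
    rewrite invfM -exprVn invf_div expr_div_n -mulrA divfK; first by rewrite mulrC.
    by rewrite expf_neq0// gt_eqF.
  apply: (le_trans (lerD missed epsle)); rewrite [leRHS]splitr lerD//.
  by rewrite ler_pM2r ?invr_gt0// expr2 ler_piMl// ltW.
apply: (@le_trans _ _ (k%:R * t%:R)); first by rewrite -natrM ler_nat card_pool.
(* As [x0 <= x], the [1] from rounding is at most [x0^-1 * x], and [ln 2] at most
   [ln 2 / x0 * x]. *)
rewrite [leRHS]mulrCA ler_pM2l//; apply: (le_trans ty).
rewrite mulrDl lerD//; last by rewrite ler_pdivlMl// mulr1.
rewrite /y mulrAC ler_pM2r ?invr_gt0// [leRHS]mulrDl lerD2r.
by rewrite mulrAC ler_pdivlMr// ler_wpM2l.
Qed.
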